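(* Let $\mathcal{D}$ be a weighted oriented graph on the vertices $x_1,\ldots,x_n$ with a leaf $x_n$, and let $R=k[x_1,\ldots,x_n]$. Suppose $x_n$ is a sink vertex, and let $x_{n-1}$ be its unique neighbor, so that $(x_{n-1},x_n)\in E(\mathcal{D})$. Then the mapping cone construction applied to the short exact sequence $$0\longrightarrow \frac{R}{I(\mathcal{D}\setminus x_n):(x_{n-1}x_n^{w_n})}(-w_n-1)\xrightarrow{\;x_{n-1}x_n^{w_n}\;}\frac{R}{I(\mathcal{D}\setminus x_n)}\longrightarrow\frac{R}{I(\mathcal{D})}\longrightarrow 0$$ provides a minimal free resolution of $R/I(\mathcal{D})$. In particular, for any $i$ and $j$, $$\beta_{i,j}(R/I(\mathcal{D}))=\beta_{i,j}(R/I(\mathcal{D}\setminus x_n))+\beta_{i-1,j-w_n-1}\big(R/(I(\mathcal{D}\setminus x_n):x_{n-1})\big).$$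
   Context: A weighted oriented graph $\mathcal{D}$ is a finite simple graph in which each edge is given exactly one orientation, together with a function $w:V(\mathcal{D})\to\mathbb{N}^+$; write $w_i=w(x_i)$ and $(x,y)$ for an edge oriented from $x$ to $y$. By convention source vertices (only outgoing edges) of the given graph have weight $1$; their weights do not affect the edge ideal. With $k$ a field and $R=k[x_1,\ldots,x_n]$, the edge ideal is $I(\mathcal{D})=(x_ix_j^{w_j} : (x_i,x_j)\in E(\mathcal{D}))$. A leaf is a vertex with exactly one incident edge; a sink is a vertex with only incoming edges. $\mathcal{D}\setminus x_n$ is the weighted oriented graph obtained by deleting $x_n$ and keeping the remaining edges, orientations and weights; $I(\mathcal{D}\setminus x_n)$ is regarded as an ideal of $R$. Mapping cone construction: given a short exact sequence $0\to A\xrightarrow{\delta} B\to C\to 0$ of graded $R$-modules, take minimal graded free resolutions $\mathcal{F}$ of $A$ and $\mathcal{G}$ of $B$ and a graded chain map $\mathcal{F}\to\mathcal{G}$ lifting $\delta$; the mapping cone of this chain map is a graded free resolution of $C$, with $i$-th free module $G_i\oplus F_{i-1}$. $\beta_{i,j}$ denotes graded Betti numbers over $R$. *)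

(* Defs.v *)
From HB Require Import structures.
From mathcomp Require Import all_boot all_order all_algebra.
From mathcomp Require Import mpoly.

Set Implicit Arguments.
Unset Strict Implicit.
Unset Printing Implicit Defensive.

Import GRing.Theory.
Local Open Scope ring_scope.

(* The vertices of a graph are some of the indices i < n of the variables, so  *)
(* that deleting a vertex does not change the ambient ring {mpoly k[n]}.       *)
Record wograph (n : nat) := WOGraph {
  vset : {set 'I_n};
  edge : rel 'I_n;
  weight : 'I_n -> nat;
  edge_vset : forall x y, edge x y -> (x \in vset) && (y \in vset);
  edge_irr : forall x, ~~ edge x x;
  edge_asym : forall x y, edge x y -> ~~ edge y x;
  weight_gt0 : forall x, (0 < weight x)%N }.

Section Graphs.
Variables (n : nat) (D : wograph n).
Implicit Types x y : 'I_n.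

Definition neighbors x : {set 'I_n} := [set y | edge D x y || edge D y x].

(* By edge_irr and edge_asym, incident edges correspond to neighbours. *)
Definition leaf x : bool := (x \in vset D) && (#|neighbors x| == 1%N).

Definition sink x : bool :=
  [&& x \in vset D, [exists y, edge D y x] & [forall y, ~~ edge D x y]].

Definition source x : bool :=
  [&& x \in vset D, [exists y, edge D x y] & [forall y, ~~ edge D y x]].

Definition sources_have_weight1 : Prop :=
  forall x, source x -> weight D x = 1%N.

Definition del_edge x : rel 'I_n :=
  fun y z => [&& y != x, z != x & edge D y z].

Lemma del_edge_vset x y z :
  del_edge x y z -> (y \in vset D :\ x) && (z \in vset D :\ x).
Proof. by case/and3P=> yx zx /edge_vset/andP[yD zD]; rewrite !inE yx zx yD. Qed.

Lemma del_edge_irr x y : ~~ del_edge x y y.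
Proof. by rewrite /del_edge (negPf (edge_irr D y)) !andbF. Qed.

Lemma del_edge_asym x y z : del_edge x y z -> ~~ del_edge x z y.
Proof.
by case/and3P=> _ _ /edge_asym/negPf zy; rewrite /del_edge zy !andbF.
Qed.

Definition del_vertex x : wograph n :=
  WOGraph (@del_edge_vset x) (@del_edge_irr x) (@del_edge_asym x) (weight_gt0 D).

End Graphs.

Section Algebra.
Variables (k : fieldType) (n : nat).
Notation R := {mpoly k[n]}.
Implicit Types (I J K : R -> Prop) (f p : R).

Definition ideal_gen (T : finType) (P : pred T) (g : T -> R) : R -> Prop :=
  fun p => exists c : T -> R, p = \sum_(t | P t) c t * g t.

Definition edge_ideal (D : wograph n) : R -> Prop :=
  ideal_gen (fun e : 'I_n * 'I_n => edge D e.1 e.2)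
            (fun e => 'X_(e.1) * 'X_(e.2) ^+ weight D e.2).

(* The colon ideal I : (f). *)
Definition colon I f : R -> Prop := fun p => I (p * f).

(* Homogeneous of degree d for the standard grading; d may be negative, in     *)
(* which case only 0 qualifies.                                                *)
Definition homog_of_deg (d : int) p : Prop :=
  forall m, m \in msupp p -> (mdeg m)%:Z = d.

(* Multiplication by f induces a short exact sequence of graded modules        *)
(* 0 -> R/J(-d) -> R/I -> R/K -> 0, the second map being the projection.       *)
Definition mul_short_exact J I K f (d : int) : Prop :=
  [/\ homog_of_deg d f,
      forall p, J p <-> I (p * f) &
      forall p, K p <-> exists q, I (p - q * f)].

(* A sequence ... -> F_1 -> F_0 -> R of graded free modules of finite rank,    *)
(* where F_i is the direct sum over a < frank i of the R(-fdeg i a). Elements  *)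
(* of F_i are row vectors and maps act by multiplication on the right, so that *)
(* fdiff i : F_(i+1) -> F_i. The map faug will induce F_0 -> R/I(-s).          *)
Record free_seq := FreeSeq {
  frank : nat -> nat;
  fdeg : forall i, 'I_(frank i) -> int;
  fdiff : forall i, 'M[R]_(frank i.+1, frank i);
  faug : 'cV[R]_(frank 0) }.

Definition graded_seq (F : free_seq) (s : int) : Prop :=
  (forall a, homog_of_deg (fdeg (i := 0) a - s) (faug F a 0)) /\
  (forall i a b,
     homog_of_deg (fdeg (i := i.+1) a - fdeg (i := i) b) (fdiff F i a b)).

(* F is a graded free resolution of R/I(-s): the last two clauses are          *)
(* exactness at F_0 and at F_(i+1).                                            *)
Definition graded_free_resolution (F : free_seq) I (s : int) : Prop :=
  [/\ graded_seq F s,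
      exists u : 'rV_(frank F 0), I ((u *m faug F) 0 0 - 1),
      forall u : 'rV_(frank F 0),
        I ((u *m faug F) 0 0) <-> exists v, u = v *m fdiff F 0 &
      forall i (u : 'rV_(frank F i.+1)),
        u *m fdiff F i = 0 <-> exists v, u = v *m fdiff F i.+1].

(* The differentials have entries in the ideal (x_1, ..., x_n). *)
Definition minimal_seq (F : free_seq) : Prop :=
  forall i a b, (fdiff F i a b)@_0%MM = 0.

Definition minimal_free_resolution (F : free_seq) I (s : int) : Prop :=
  graded_free_resolution F I s /\ minimal_seq F.

Definition seq_map (F G : free_seq) := forall i, 'M[R]_(frank F i, frank G i).

(* phi is a graded chain map F -> G lifting multiplication by f with values    *)
(* in R/I, where G is a resolution of R/I.                                     *)
Definition graded_lift (F G : free_seq) (phi : seq_map F G) I f : Prop :=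
  [/\ forall i a b, homog_of_deg (fdeg (i := i) a - fdeg (i := i) b) (phi i a b),
      forall i, phi i.+1 *m fdiff G i = fdiff F i *m phi i &
      forall a, I ((phi 0%N *m faug G) a 0 - faug F a 0 * f)].

Section MappingCone.
Variables (F G : free_seq) (phi : seq_map F G).

Definition cone_rank (i : nat) : nat :=
  if i is j.+1 then (frank G j.+1 + frank F j)%N else frank G 0.

Definition cone_deg (i : nat) : 'I_(cone_rank i) -> int :=
  match i return 'I_(cone_rank i) -> int with
  | 0 => fdeg (f := G) (i := 0)
  | j.+1 => fun a => match split a with
                     | inl b => fdeg (f := G) b
                     | inr c => fdeg (f := F) c
                     end
  end.

(* (g, h) in G_(i+1) (+) F_i is sent to (d g + phi h, - d h). *)
Definition cone_diff (i : nat) : 'M[R]_(cone_rank i.+1, cone_rank i) :=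
  match i return 'M[R]_(cone_rank i.+1, cone_rank i) with
  | 0 => col_mx (fdiff G 0) (phi 0%N)
  | j.+1 => block_mx (fdiff G j.+1) 0 (phi j.+1) (- fdiff F j)
  end.

Definition mapping_cone : free_seq :=
  FreeSeq cone_deg cone_diff (faug G : 'cV_(cone_rank 0)).

End MappingCone.

(* The number of summands R(-j) of F_i, with F_i = 0 for i < 0. *)
Definition num_summands (F : free_seq) (i j : int) : nat :=
  if i is Posz m then #|[set a : 'I_(frank F m) | fdeg a == j]| else 0%N.

(* b is the graded Betti number beta_{i,j}(R/I). *)
Definition graded_betti I (i j : int) (b : nat) : Prop :=
  exists2 F : free_seq,
    minimal_free_resolution F I 0 & num_summands F i j = b.

End Algebra.

(* Main.v *)
Require Import Defs.
From HB Require Import structures.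
From mathcomp Require Import all_boot all_order all_algebra.
From mathcomp Require Import mpoly.
From mathcomp Require Import zify ring.
From Stdlib Require Import IndefiniteDescription.

Set Implicit Arguments.
Unset Strict Implicit.
Unset Printing Implicit Defensive.

Import GRing.Theory.
Local Open Scope ring_scope.

(** Let x be the leaf, y its neighbour, w the weight of x, f = y x^w, and let I
    be the edge ideal of the graph without x. As x is a sink, the only edge at x
    is (y, x), so the edge ideal of the whole graph is I + (f); this gives the
    short exact sequence. The mapping cone of a lift phi of multiplication by f
    is then a resolution, by a diagram chase (cone_resolution), and a lift
    exists by the comparison theorem for graded free resolutions
    (graded_lift_exists).

    The cone is minimal as soon as the entries of phi have no constant term.
    The generators of I do not involve x, so x is a nonzerodivisor modulo I
    (ideal_gen_cancelX) and I : f = I : y. Hence multiplication by y also maps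
    R/(I : f) to R/I; if psi lifts it, then x^w psi is a lift of multiplication
    by f, and its entries have no constant term because w > 0. Any other lift
    phi differs from it by a null-homotopic chain map d h + h d, whose entries
    have no constant term because both resolutions are minimal
    (null_lift_constant_part).

    The same fact shows that graded Betti numbers are well defined
    (num_summands_le): given two minimal resolutions of R/I, the comparison maps
    between them are mutually inverse modulo the variables, and their constant
    terms only relate generators of equal degrees. The formula for the Betti
    numbers is thus read off the ranks of the mapping cone. *)

(** * Dependent choice *)

Lemma dependent_choice (T : nat -> Type) (P : forall i, T i -> Prop)
    (Q : forall i, T i -> T i.+1 -> Prop) :
  (exists x, P 0%N x) ->
  (forall i x, P i x -> exists2 y, P i.+1 y & Q i x y) ->
  exists f : forall i, T i, forall i, P i (f i) /\ Q i (f i) (f i.+1).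
Proof.
move=> ex0 exS; have [x0 Px0] := constructive_indefinite_description _ ex0.
have next i (x : {x | P i x}) : {y : {y | P i.+1 y} | Q i (sval x) (sval y)}.
  apply: constructive_indefinite_description.
  by case: x => x Px; have [y Py Qxy] := exS _ _ Px; exists (exist _ y Py).
pose f := fix f i : {x | P i x} :=
  if i is j.+1 then sval (next j (f j)) else exist _ x0 Px0.
exists (fun i => sval (f i)) => i.
by split; [exact: svalP | exact: svalP (next i (f i))].
Qed.

(** * Homogeneous parts and graded ideals *)

Section Homogeneous.
Variables (k : fieldType) (n : nat).
Notation R := {mpoly k[n]}.
Implicit Types (I J : R -> Prop) (p q : R) (d e : int).

(** The homogeneous part of degree d of p; it is 0 when d is negative. *)
Definition hpart d p : R := if d is Posz m then pihomog mdeg m p else 0.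

Lemma mcoeff_hpart d p m :
  (hpart d p)@_m = if (mdeg m)%:Z == d then p@_m else 0.
Proof.
case: d => [d|d] /=; last by rewrite mcoeff0.
elim/mpolyind: p => [|c m' p _ _ IHp].
  by rewrite pihomog0 mcoeff0 if_same.
rewrite linearP /= pihomogX !mcoeffD !mcoeffZ {}IHp eqz_nat mcoeffX.
case: (eqVneq (mdeg m') d) => [<-|ne]; rewrite ?mcoeff0 ?mcoeffX.
  case: (eqVneq m' m) => [->|]; rewrite ?eqxx // mulr0 => _.
  by case: ifP; rewrite ?addr0.
case: (eqVneq m' m) => [<-|]; first by rewrite (negPf ne) mulr0 addr0.
by rewrite mulr0 !add0r.
Qed.

Lemma homog_coeff d p :
  homog_of_deg d p <-> forall m, (mdeg m)%:Z != d -> p@_m = 0.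
Proof.
split=> [hp m /eqP ne|hp m].
  by apply/eqP; rewrite mcoeff_eq0; apply/negP => /hp.
by move=> hm; apply/eqP/(contraTT _ hm) => /hp/eqP; rewrite mcoeff_eq0.
Qed.

Lemma homog_hpart d p : homog_of_deg d (hpart d p).
Proof. by apply/homog_coeff => m /negPf dm; rewrite mcoeff_hpart dm. Qed.

Lemma hpart_id d p : homog_of_deg d p -> hpart d p = p.
Proof.
move/homog_coeff => hp; apply/mpolyP => m; rewrite mcoeff_hpart.
by case: ifPn => // /hp.
Qed.

Lemma hpartB d : {morph hpart d : p q / p - q}.
Proof.
by case: d => d p q /=; rewrite ?raddfB ?subr0.
Qed.

Lemma hpart_sum d (T : finType) (P : pred T) (g : T -> R) :
  hpart d (\sum_(t | P t) g t) = \sum_(t | P t) hpart d (g t).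
Proof. by case: d => d /=; [rewrite linear_sum | rewrite big1]. Qed.

(** Multiplication by a homogeneous element commutes with taking parts. *)
Lemma hpartM d e p q :
  homog_of_deg e q -> hpart (d + e) (p * q) = hpart d p * q.
Proof.
move=> /homog_coeff hq; apply/mpolyP => m; rewrite mcoeff_hpart !mcoeffM.
case: ifPn => [|] hm; last apply/esym/big1; first apply: eq_bigr;
  move=> [m1 m2] /= /eqP/(congr1 mdeg); rewrite mdegD => Dm;
  rewrite mcoeff_hpart; case: eqP => // hm1;
  have [hm2|/hq->] := eqVneq (mdeg m2)%:Z e; rewrite ?mulr0 ?mul0r //; lia.
Qed.

Lemma homogM d e p q :
  homog_of_deg d p -> homog_of_deg e q -> homog_of_deg (d + e) (p * q).
Proof.
move=> hp hq; rewrite -(hpart_id hp) -(hpartM _ _ hq); exact: homog_hpart.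
Qed.

Lemma homog1 : homog_of_deg 0 (1 : R).
Proof. by move=> m; rewrite msupp1 inE => /eqP->; rewrite mdeg0. Qed.

Lemma homogXU i : homog_of_deg 1 ('X_i : R).
Proof. by move=> m; rewrite msuppX inE => /eqP->; rewrite mdeg1. Qed.

Lemma homogXUn i (e : nat) : homog_of_deg e%:Z ('X_i ^+ e : R).
Proof.
elim: e => [|e IHe]; first exact: homog1.
by rewrite exprS intS; apply: homogM => //; apply: homogXU.
Qed.

(** Homogeneous ideals: ideals closed under homogeneous parts. *)
Record graded_ideal I : Prop := GradedIdeal {
  gideal0 : I 0;
  gidealD : forall p q, I p -> I q -> I (p + q);
  gidealM : forall p q, I q -> I (p * q);
  gideal_hpart : forall d p, I p -> I (hpart d p) }.

Section IdealTheory.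
Variables (I : R -> Prop) (gI : graded_ideal I).

Lemma gidealN p : I p -> I (- p).
Proof. by rewrite -mulN1r => Ip; apply: (gidealM gI). Qed.

Lemma gidealB p q : I p -> I q -> I (p - q).
Proof. by move=> Ip /gidealN Iq; apply: (gidealD gI). Qed.

Lemma gideal_sum (T : finType) (P : pred T) (g : T -> R) :
  (forall t, P t -> I (g t)) -> I (\sum_(t | P t) g t).
Proof.
by move=> Ig; elim/big_ind: _ => //; [apply: (gideal0 gI)|apply: (gidealD gI)].
Qed.

Lemma gideal_mulmx m1 m2 (A : 'M[R]_(m1, m2)) (u : 'cV[R]_m2) a :
  (forall b, I (u b 0)) -> I ((A *m u) a 0).
Proof.
by move=> Iu; rewrite mxE; apply: gideal_sum => b _; apply: (gidealM gI).
Qed.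

Lemma colon_graded e f : homog_of_deg e f -> graded_ideal (colon I f).
Proof.
move=> hf; rewrite /colon; split=> [|p q|p q|d p].
- by rewrite mul0r; apply: (gideal0 gI).
- by rewrite mulrDl; apply: (gidealD gI).
- by rewrite -mulrA; apply: (gidealM gI).
- by rewrite -(hpartM _ _ hf); apply: (gideal_hpart gI).
Qed.

End IdealTheory.

Lemma ideal_gen_graded (T : finType) (P : pred T) (g : T -> R) (e : T -> int) :
  (forall t, P t -> homog_of_deg (e t) (g t)) -> graded_ideal (ideal_gen P g).
Proof.
move=> hg; split=> [|_ _ [c1 ->] [c2 ->]|p _ [c ->]|d _ [c ->]].
- by exists (fun=> 0); rewrite big1 // => t _; rewrite mul0r.
- exists (fun t => c1 t + c2 t).
  by rewrite -big_split; apply: eq_bigr => t _; rewrite mulrDl.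
- exists (fun t => p * c t).
  by rewrite mulr_sumr; apply: eq_bigr => t _; rewrite mulrA.
exists (fun t => hpart (d - e t) (c t)); rewrite hpart_sum.
by apply: eq_bigr => t Pt; rewrite -(hpartM _ _ (hg t Pt)) subrK.
Qed.

Lemma edge_ideal_graded (D : wograph n) : graded_ideal (edge_ideal (k := k) D).
Proof.
pose deg (e : 'I_n * 'I_n) : int := 1 + (weight D e.2)%:Z.
apply: (ideal_gen_graded (e := deg)) => e _.
rewrite /deg; apply: homogM; [exact: homogXU | exact: homogXUn].
Qed.

(** The matrices of degree-preserving maps between graded free modules, whose
    generators have degrees given by r (rows) and c (columns). *)
Definition graded_mx m1 m2 (r : 'I_m1 -> int) (c : 'I_m2 -> int)
    (A : 'M[R]_(m1, m2)) :=
  forall a b, homog_of_deg (r a - c b) (A a b).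

(** The degree-preserving part of a map of graded free modules. *)
Definition hpart_mx m1 m2 (r : 'I_m1 -> int) (c : 'I_m2 -> int)
    (A : 'M[R]_(m1, m2)) :=
  \matrix_(a, b) hpart (r a - c b) (A a b).

Lemma graded_hpart_mx m1 m2 (r : 'I_m1 -> int) (c : 'I_m2 -> int) A :
  graded_mx r c (hpart_mx r c A).
Proof. by move=> a b; rewrite mxE; apply: homog_hpart. Qed.

Lemma hpart_mx_id m1 m2 (r : 'I_m1 -> int) (c : 'I_m2 -> int) A :
  graded_mx r c A -> hpart_mx r c A = A.
Proof. by move=> hA; apply/matrixP => a b; rewrite mxE hpart_id. Qed.

Lemma hpart_mxM m1 m2 m3 (r : 'I_m1 -> int) (c : 'I_m2 -> int)
    (e : 'I_m3 -> int) A B :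
  graded_mx c e B -> hpart_mx r e (A *m B) = hpart_mx r c A *m B.
Proof.
move=> hB; apply/matrixP => a b; rewrite !mxE hpart_sum.
apply: eq_bigr => l _; rewrite mxE -(hpartM _ _ (hB l b)).
by rewrite addrA subrK.
Qed.

Lemma graded_mxM m1 m2 m3 (r : 'I_m1 -> int) (c : 'I_m2 -> int)
    (e : 'I_m3 -> int) A B :
  graded_mx r c A -> graded_mx c e B -> graded_mx r e (A *m B).
Proof.
move=> hA hB; rewrite -(hpart_mx_id hA) -(hpart_mxM _ _ hB).
exact: graded_hpart_mx.
Qed.

(** A matrix factors through B if its rows do. *)
Lemma mulmx_rows m1 m2 m3 (A : 'M[R]_(m1, m3)) (B : 'M[R]_(m2, m3)) :
  (forall a, exists v : 'rV_m2, row a A = v *m B) -> exists V, A = V *m B.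
Proof.
move/fin_all_exists => [f Df]; exists (\matrix_a f a).
by apply/row_matrixP => a; rewrite row_mul rowK Df.
Qed.

End Homogeneous.

Lemma mx_subE (V : zmodType) m1 m2 (A B : 'M[V]_(m1, m2)) a b :
  (A - B) a b = A a b - B a b.
Proof. by rewrite !mxE. Qed.

(** * Graded free resolutions *)

Section Resolutions.
Variables (k : fieldType) (n : nat).
Notation R := {mpoly k[n]}.
Implicit Types (I J : R -> Prop) (F G : free_seq k n) (s t c : int).

Lemma eq_minimal_free_resolution F I J s :
  (forall p, I p <-> J p) ->
  minimal_free_resolution F I s -> minimal_free_resolution F J s.
Proof.
move=> IJ [[gF [u Iu] exF0 exF] minF]; split=> //; split=> //.
  by exists u; apply/IJ.
by move=> v; rewrite -exF0; split=> /IJ.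
Qed.

Section Exactness.
Variables (F : free_seq k n) (I : R -> Prop) (s : int).
Hypothesis resF : graded_free_resolution F I s.

Lemma graded_fdiff i :
  graded_mx (fdeg (f := F) (i := i.+1)) (fdeg (i := i)) (fdiff F i).
Proof. by case: resF => [[_ gF] _ _ _] a b; apply: gF. Qed.

Lemma graded_faug : graded_mx (fdeg (f := F) (i := 0)) (fun=> s) (faug F).
Proof. by case: resF => [[gF _] _ _ _] a b; rewrite ord1; apply: gF. Qed.

(** The exactness conditions, for several row vectors at a time. *)
Lemma exact0_mx m (U : 'M[R]_(m, frank F 0)) :
  (forall a, I ((U *m faug F) a 0)) <-> exists V, U = V *m fdiff F 0.
Proof.
case: resF => _ _ exF0 _; split=> [IU|[V ->] a].
  apply: mulmx_rows => a; apply/exF0; rewrite -row_mul mxE; exact: IU.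
have [_] := exF0 (row a V *m fdiff F 0) => /(_ (ex_intro _ _ erefl)).
by rewrite -mulmxA -row_mul mulmxA mxE.
Qed.

Lemma exactS_mx i m (U : 'M[R]_(m, frank F i.+1)) :
  U *m fdiff F i = 0 <-> exists V, U = V *m fdiff F i.+1.
Proof.
case: resF => _ _ _ exF; split=> [U0|[V ->]].
  by apply: mulmx_rows => a; apply/exF; rewrite -row_mul U0 row0.
apply/row_matrixP => a; rewrite !row_mul row0.
by apply/exF; exists (row a V).
Qed.

Lemma fdiffM i : fdiff F i.+1 *m fdiff F i = 0.
Proof. by apply/exactS_mx; exists 1%:M; rewrite mul1mx. Qed.

Lemma fdiff_faug a : I ((fdiff F 0 *m faug F) a 0).
Proof. by move: a; apply/exact0_mx; exists 1%:M; rewrite mul1mx. Qed.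

End Exactness.

(** The comparison theorem: a homogeneous g that multiplies J into I induces a
    map from R/J to R/I, which lifts to a chain map phi. If phi raises degrees
    by c, then g has degree c + s - t because F resolves R/J(-s) and G resolves
    R/I(-t). *)
Lemma graded_lift_exists F G I J s t c g :
    graded_ideal I ->
    graded_free_resolution F J s -> graded_free_resolution G I t ->
    homog_of_deg (c + s - t) g -> (forall p, J p -> I (p * g)) ->
  exists phi : seq_map F G,
    [/\ forall i, graded_mx (fun a => fdeg a + c) (fdeg (i := i)) (phi i),
        forall i, phi i.+1 *m fdiff G i = fdiff F i *m phi i &
        forall a, I ((phi 0 *m faug G) a 0 - faug F a 0 * g)].
Proof.
move=> gI resF resG hg JI.
(* The phi_i come from dependent choice. By the invariant P, phi_i is graded,  *)
(* phi_(i+1) exists, and phi_0 lifts multiplication by g; hpart_mx makes each  *)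
(* choice graded.                                                              *)
pose gr i := @graded_mx k n _ _ (fun a => fdeg (f := F) (i := i) a + c)
                (fdeg (f := G) (i := i)).
pose P i (A : 'M[R]_(frank F i, frank G i)) :=
  [/\ gr i A, exists V, fdiff F i *m A = V *m fdiff G i &
      match i return 'M[R]_(frank F i, frank G i) -> Prop with
      | 0 => fun A => forall a, I ((A *m faug G - faug F *m g%:M) a 0)
      | _ => fun=> True
      end A].
pose Q i (A : 'M[R]_(frank F i, frank G i)) B :=
  B *m fdiff G i = fdiff F i *m A.
have [||phi phiP] := @dependent_choice _ P Q.
- have [_ [u Iu] _ _] := resG.
  have gFg : graded_mx (fun a => fdeg (f := F) (i := 0) a + c) (fun=> t)
               (faug F *m g%:M).
    move=> a b; rewrite [b]ord1 mul_mx_scalar mxE mulrC.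
    have -> : fdeg a + c - t = (fdeg a - s) + (c + s - t) by ring.
    by apply: homogM => //; apply: (graded_faug resF).
  (* u represents 1 in R/I, so g (faug F) u maps to g (faug F) in R/I. *)
  pose A := hpart_mx (fun a => fdeg (f := F) a + c) (fdeg (f := G) (i := 0))
              (faug F *m g%:M *m u).
  have IA a : I ((A *m faug G - faug F *m g%:M) a 0).
    rewrite -(hpart_mxM _ _ (graded_faug resG)) -{2}(hpart_mx_id gFg).
    rewrite mx_subE [X in X - _]mxE [X in _ - X]mxE -hpartB.
    apply: (gideal_hpart gI).
    rewrite -mulmxA mxE big_ord1 -[X in _ - X]mulr1 -mulrBr.
    exact: (gidealM gI).
  exists A; split=> //; first exact: graded_hpart_mx.
  apply/(exact0_mx resG) => a; rewrite -mulmxA.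
  rewrite -[A *m _](subrK (faug F *m g%:M)) mulmxDr mxE.
  apply: (gidealD gI); first exact: (gideal_mulmx gI).
  rewrite mulmxA mul_mx_scalar mxE mulrC; apply: JI.
  exact: (fdiff_faug resF).
- move=> i A [gA [V DV] _].
  pose B := hpart_mx (fun a => fdeg (f := F) a + c)
              (fdeg (f := G) (i := i.+1)) V.
  have DB : B *m fdiff G i = fdiff F i *m A.
    rewrite -(hpart_mxM _ _ (graded_fdiff (i := i) resG)) -DV.
    apply: hpart_mx_id; apply: graded_mxM gA => a b.
    by rewrite opprD addrACA subrr addr0; apply: (graded_fdiff resF).
  exists B => //; split=> //; first exact: graded_hpart_mx.
  apply/(exactS_mx resG); rewrite -mulmxA DB mulmxA (fdiffM resF).
  by rewrite mul0mx.
exists phi; split=> [i|i|a].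
- by have [[]] := phiP i.
- by have [] := phiP i.
have [[_ _ /(_ a)]] := phiP 0%N.
by rewrite mx_subE mul_mx_scalar [X in _ - X]mxE mulrC.
Qed.

Lemma constant_part_mulmx m1 m2 m3 (A : 'M[R]_(m1, m2)) (B : 'M[R]_(m2, m3)) :
  map_mx (mcoeff 0%MM) (A *m B) =
  map_mx (mcoeff 0%MM) A *m map_mx (mcoeff 0%MM) B.
Proof. exact: map_mxM. Qed.

Lemma minimal_constant_part F i :
  minimal_seq F -> map_mx (mcoeff 0%MM) (fdiff F i) = 0.
Proof. by move=> minF; apply/matrixP => a b; rewrite !mxE minF. Qed.

(** A chain map that lifts the zero map is null-homotopic, hence has no constant
    term when both F and G are minimal. *)
Lemma null_lift_constant_part F G I t (delta : seq_map F G) :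
    minimal_seq F -> (forall i, fdiff F i.+1 *m fdiff F i = 0) ->
    minimal_free_resolution G I t ->
    (forall i, delta i.+1 *m fdiff G i = fdiff F i *m delta i) ->
    (forall a, I ((delta 0%N *m faug G) a 0)) ->
  forall i, map_mx (mcoeff 0%MM) (delta i) = 0.
Proof.
move=> minF dF [resG minG] chain lift i.
(* If delta_i = h_i d + d h_(i-1), as matrices, with h the homotopy, then      *)
(* delta_i - h_i d is d h_(i-1): d times it is 0, and d has no constant term.  *)
suff [h _ h0] : exists2 h, fdiff F i *m (delta i - h *m fdiff G i) = 0 &
    map_mx (mcoeff 0%MM) (delta i - h *m fdiff G i) = 0.
  move: h0; rewrite map_mxB constant_part_mulmx (minimal_constant_part _ minG).
  by rewrite mulmx0 subr0.
elim: i => [|i [h hF h0]].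
  have /(exact0_mx resG)[h Dh] := lift.
  by exists h; rewrite -Dh subrr ?mulmx0 ?map_mx0.
have /(exactS_mx resG)[h' Dh'] : (delta i.+1 - fdiff F i *m h) *m fdiff G i = 0.
  by rewrite mulmxBl chain -mulmxA -mulmxBr.
exists h'; rewrite -Dh' opprB addrC subrK.
  by rewrite mulmxA dF mul0mx.
by rewrite constant_part_mulmx (minimal_constant_part _ minF) mul0mx.
Qed.

(** * The mapping cone *)

Section Cone.
Variables (F G : free_seq k n) (I J : R -> Prop) (f : R) (s : int).
Variable phi : seq_map F G.
Hypothesis gI : graded_ideal I.
Hypothesis JE : forall p, J p <-> I (p * f).
Hypothesis gJ : graded_ideal J.
Hypothesis resF : graded_free_resolution F J s.
Hypothesis resG : graded_free_resolution G I 0.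
Hypothesis liftphi : graded_lift phi I f.

Lemma graded_cone : graded_seq (mapping_cone phi) 0.
Proof.
have [gphi _ _] := liftphi; have [[gG0 gG] _ _ _] := resG.
have [[gF0 gF] _ _ _] := resF; split=> [|i a b]; first exact: gG0.
case: i a b => [|i] /= a b.
  by rewrite !mxE; case: (split a) => c.
rewrite !mxE; case: (split a) => c; rewrite !mxE; case: (split b) => d //.
  by move=> m; rewrite mxE msupp0.
move=> m; rewrite mxE (perm_mem (msuppN _)); exact: gF.
Qed.

(** On all of F_0, phi lifts multiplication by f. *)
Lemma lift_row (v : 'rV_(frank F 0)) :
  I ((v *m phi 0%N *m faug G) 0 0 - (v *m faug F) 0 0 * f).
Proof.
have [_ _ lift] := liftphi.
have -> : (v *m phi 0%N *m faug G) 0 0 - (v *m faug F) 0 0 * f =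
    (v *m (phi 0%N *m faug G - faug F *m f%:M)) 0 0.
  rewrite mulmxBr !mulmxA mul_mx_scalar mx_subE.
  by rewrite [X in _ = _ - X]mxE (mulrC f).
apply: (gideal_mulmx gI) => a; move: (lift a).
by rewrite mul_mx_scalar mx_subE [X in _ -> I (_ - X)]mxE mulrC.
Qed.

Lemma cone_exact0 (K : R -> Prop) (u : 'rV_(frank G 0)) :
  (forall p, K p <-> exists q, I (p - q * f)) ->
  K ((u *m faug G) 0 0) <-> exists v, u = v *m cone_diff phi 0.
Proof.
move=> KE; rewrite KE; split=> [[q Iq]|[v ->]].
  (* u0 represents 1 in R/J, so that q is the image of q u0 modulo J. *)
  have [_ [u0 Ju0] _ _] := resF.
  have Jq : J (((q *: u0) *m faug F) 0 0 - q).
    by rewrite -scalemxAl mxE -[X in _ - X]mulr1 -mulrBr; apply: (gidealM gJ).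
  have /(exact0_mx resG)[v Dv] a :
      I (((u - q *: u0 *m phi 0%N) *m faug G) a 0).
    rewrite [a]ord1 mulmxBl mx_subE.
    have /JE := Jq; rewrite mulrBl => Iq'.
    have := gidealD gI (gidealD gI (lift_row (q *: u0)) Iq') (gidealN gI Iq).
    by move/(gidealN gI); congr I; ring.
  exists (row_mx v (q *: u0)).
  by rewrite /= mul_row_col -Dv subrK.
rewrite -[v]hsubmxK /= mul_row_col mulmxDl mxE.
exists ((rsubmx v *m faug F) 0 0); rewrite -addrA.
apply: (gidealD gI); last exact: lift_row.
by have [_] := exact0_mx resG (lsubmx v *m fdiff G 0); apply; exists (lsubmx v).
Qed.

Lemma cone_exactS i (u : 'rV_(cone_rank F G i.+1)) :
  u *m cone_diff phi i = 0 <-> exists v, u = v *m cone_diff phi i.+1.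
Proof.
have [_ chain lift] := liftphi.
have dd : cone_diff phi i.+1 *m cone_diff phi i = 0.
  case: i {u} => [|i] /=.
    rewrite mul_block_col mul0mx addr0 (fdiffM resG) chain mulNmx subrr.
    by rewrite col_mx0.
  rewrite mulmx_block (fdiffM resG) !mul0mx !mulmx0 !addr0 add0r chain.
  by rewrite mulNmx subrr mulmxN mulNmx opprK (fdiffM resF) block_mx0.
split=> [|[v ->]]; last by rewrite -mulmxA dd mulmx0.
case: i u {dd} => [|i] /= u; rewrite -{1}[u]hsubmxK.
all: set g := lsubmx u; set h := rsubmx u.
  rewrite mul_row_col => u0.
  have /(exact0_mx resF)[h1 Dh] a : J ((h *m faug F) a 0).
    (* In R/I, f times the image of h is the image of phi_0 h = - d g, so 0. *)
    rewrite [a]ord1; apply/JE.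
    have Ig : I ((h *m phi 0%N *m faug G) 0 0).
      have [_] := exact0_mx resG (h *m phi 0%N); apply; exists (- g).
      by apply/eqP; rewrite mulNmx -addr_eq0 addrC u0.
    rewrite -[_ * f](subKr ((h *m phi 0%N *m faug G) 0 0)).
    by apply: gidealB => //; apply: lift_row.
  have /(exactS_mx resG)[g2 Dg] : (g + h1 *m phi 1%N) *m fdiff G 0 = 0.
    by rewrite mulmxDl -mulmxA chain mulmxA -Dh.
  exists (row_mx g2 (- h1)); rewrite mul_row_block mulNmx -Dg addrK.
  by rewrite mulmx0 add0r mulNmx mulmxN opprK -Dh hsubmxK.
rewrite mul_row_block mulmx0 add0r -row_mx0 => /eq_row_mx[gh h0].
have /(exactS_mx resF)[h1 Dh] : h *m fdiff F i = 0.
  by apply/eqP; rewrite -oppr_eq0 -mulmxN h0.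
have /(exactS_mx resG)[g2 Dg] : (g + h1 *m phi i.+2) *m fdiff G i.+1 = 0.
  by rewrite mulmxDl -mulmxA chain mulmxA -Dh.
exists (row_mx g2 (- h1)); rewrite mul_row_block mulNmx -Dg addrK.
by rewrite mulmx0 add0r mulNmx mulmxN opprK -Dh hsubmxK.
Qed.

Lemma cone_resolution (K : R -> Prop) :
  (forall p, K p <-> exists q, I (p - q * f)) ->
  graded_free_resolution (mapping_cone phi) K 0.
Proof.
move=> KE; split; first exact: graded_cone.
- have [_ [u Iu] _ _] := resG; exists u; apply/KE; exists 0.
  by rewrite mul0r subr0.
- by move=> u; apply: cone_exact0.
by move=> i u; apply: cone_exactS.
Qed.

Lemma cone_minimal :
  minimal_seq F -> minimal_seq G ->
  (forall i, map_mx (mcoeff 0%MM) (phi i) = 0) ->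
  minimal_seq (mapping_cone phi).
Proof.
move=> minF minG phi0 i a b.
have phi0E j a' b' : (phi j a' b')@_0 = 0.
  by have /matrixP/(_ a' b') := phi0 j; rewrite !mxE.
case: i a b => [|i] /= a b; rewrite mxE; case: (split a) => c //.
  by rewrite mxE; case: (split b) => d; rewrite ?mxE ?mcoeff0.
by rewrite mxE; case: (split b) => d; rewrite ?mxE ?mcoeffN ?minF ?oppr0.
Qed.

End Cone.

(** * Graded Betti numbers *)

Lemma num_summands_cone F G (phi : seq_map F G) (i j : int) :
  num_summands (mapping_cone phi) i j =
    (num_summands G i j + num_summands F (i - 1) j)%N.
Proof.
case: i => [[|i]|i]; [by rewrite addn0 | | by []].
have -> : Posz i.+1 - 1 = i by rewrite intS addrC addKr.
rewrite /= -!sum1_card !(eq_bigl _ _ (fun a => in_set _ a)) big_split_ord /=.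
congr (_ + _)%N; apply: eq_bigl => a /=.
  by rewrite (unsplitK (inl a)).
by rewrite (unsplitK (inr a)).
Qed.

(** The sequence F(-c), in which all degrees are increased by c. *)
Definition fdeg_shift F c : free_seq k n :=
  FreeSeq (fun i a => fdeg (f := F) (i := i) a + c) (fdiff F) (faug F).

Lemma num_summands_shift F c (i j : int) :
  num_summands (fdeg_shift F c) i j = num_summands F i (j - c).
Proof.
case: i => //= i; apply: eq_card => a.
by rewrite !inE /= eq_sym -subr_eq eq_sym.
Qed.

Lemma shift_resolution F I s c :
  minimal_free_resolution F I s ->
  minimal_free_resolution (fdeg_shift F c) I (s + c).
Proof.
move=> [[[gF0 gF] ? ? ?] ?]; split=> //; split=> //; split=> [a|i a b] /=.
  by rewrite opprD addrACA subrr addr0.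
by rewrite opprD addrACA subrr addr0.
Qed.

(** Exchanging F and G, minimal resolutions of the same module have the same
    number of generators in each degree. *)
Lemma num_summands_le F G I (i j : int) :
  graded_ideal I ->
  minimal_free_resolution F I 0 -> minimal_free_resolution G I 0 ->
  (num_summands F i j <= num_summands G i j)%N.
Proof.
move=> gI mF mG; have [[resF minF] [resG minG]] := (mF, mG).
have lift1 F' G' :
    graded_free_resolution F' I 0 -> graded_free_resolution G' I 0 ->
    exists phi : seq_map F' G',
    [/\ forall i, graded_mx (fdeg (i := i)) (fdeg (i := i)) (phi i),
        forall i, phi i.+1 *m fdiff G' i = fdiff F' i *m phi i &
        forall a, I ((phi 0%N *m faug G') a 0 - faug F' a 0)].
  move=> resF' resG'.
  have [||phi [gphi chain lift]] :=
    graded_lift_exists (c := 0) (g := 1) gI resF' resG'.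
  - exact: homog1.
  - by move=> p; rewrite mulr1.
  exists phi; split=> // [l a b|a]; first by have := gphi l a b; rewrite addr0.
  by have := lift a; rewrite mulr1.
have [alpha [galpha chA liftA]] := lift1 _ _ resF resG.
have [beta [gbeta chB liftB]] := lift1 _ _ resG resF.
pose cst m1 m2 (A : 'M[R]_(m1, m2)) := map_mx (mcoeff 0%MM) A.
(* beta o alpha - 1 lifts the zero map. *)
have ab1 l : cst _ _ (alpha l) *m cst _ _ (beta l) = 1%:M.
  suff: cst _ _ (alpha l *m beta l - 1%:M) = 0.
    rewrite /cst map_mxB constant_part_mulmx map_mx1 => /eqP.
    by rewrite subr_eq0 => /eqP.
  move: l; pose delta l := alpha l *m beta l - 1%:M.
  apply: (null_lift_constant_part (delta := delta) minF (fdiffM resF) mF)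
    => [l|a]; rewrite /delta.
    by rewrite mulmxBl mulmxBr mul1mx mulmx1 -mulmxA chB !mulmxA chA.
  have -> : (alpha 0%N *m beta 0%N - 1%:M) *m faug F =
    alpha 0%N *m (beta 0%N *m faug F - faug G) + (alpha 0%N *m faug G - faug F).
    by rewrite mulmxBl mul1mx mulmxBr mulmxA addrA subrK.
  rewrite mxE; apply: (gidealD gI); last by rewrite mx_subE.
  by apply: (gideal_mulmx gI) => b; rewrite mx_subE.
case: i => // i /=.
(* Only the blocks of degree j of alpha and beta matter in degree j. *)
pose S := [set a | fdeg (f := F) (i := i) a == j].
pose T := [set a | fdeg (f := G) (i := i) a == j].
pose A := mxsub (@enum_val _ (mem S)) (@enum_val _ (mem T)) (cst _ _ (alpha i)).
pose B := mxsub (@enum_val _ (mem T)) (@enum_val _ (mem S)) (cst _ _ (beta i)).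
have: A *m B = 1%:M.
  apply/matrixP => a b; have /matrixP/(_ (enum_val a) (enum_val b)) := ab1 i.
  rewrite !mxE (inj_eq enum_val_inj) => <-.
  rewrite [RHS](bigID (mem T)) /= [X in _ = _ + X]big1 ?addr0 => [|c /negP cT].
    by rewrite [RHS]big_enum_val; apply: eq_bigr => c _; rewrite !mxE.
  have /homog_coeff/(_ 0%MM) := galpha i (enum_val a) c.
  rewrite !mxE mdeg0 => -> //; first by rewrite mul0r.
  have := enum_valP a; rewrite inE => /eqP->.
  by rewrite eq_sym subr_eq0 eq_sym; apply/negP; move: cT; rewrite inE.
exact: mulmx1_min.
Qed.

End Resolutions.

(** * Variables that are nonzerodivisors *)

Section Substitution.
Variables (k : fieldType) (n : nat) (x : 'I_n).
Notation R := {mpoly k[n]}.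
Implicit Types p q : R.

(** The substitution of 0 for the variable x. *)
Definition at0 p : R := p \mPo [tuple if i == x then 0 else 'X_i | i < n].

Lemma at0M p q : at0 (p * q) = at0 p * at0 q.
Proof. exact: rmorphM. Qed.

Lemma at0XU i : at0 'X_i = if i == x then 0 else 'X_i.
Proof. by rewrite /at0 comp_mpolyXU -tnth_nth tnth_mktuple. Qed.

Lemma at0_split p : exists q, p = q * 'X_x + at0 p.
Proof.
pose S p := exists q, p = q * 'X_x + at0 p.
have SM p1 p2 : S p1 -> S p2 -> S (p1 * p2).
  move=> [q1 D1] [q2 D2]; exists (q1 * p2 + at0 p1 * q2).
  by rewrite at0M {1}D1 {1}D2 {2}D2; ring.
have SX i : S 'X_i.
  rewrite /S at0XU; case: eqP => [->|_]; first by exists 1; rewrite mul1r addr0.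
  by exists 0; rewrite mul0r add0r.
have S1 : S 1 by exists 0; rewrite mul0r add0r /at0 comp_mpoly1.
have SXn i e : S ('X_i ^+ e) by elim: e => // e IHe; rewrite exprS; apply: SM.
rewrite -/(S p); elim/mpolyind: p => [|c m p _ _ [q Dp]].
  by exists 0; rewrite mul0r add0r /at0 comp_mpoly0.
have [q' Dm] : S 'X_[m] by rewrite mpolyXE_id; apply: big_ind.
exists (c *: q' + q); rewrite [at0 _]linearP /= -!/(at0 _) {1}Dp {1}Dm.
by rewrite scalerDr mulrDl addrACA -scalerAl.
Qed.

(** The variable x is a nonzerodivisor modulo an ideal whose generators do not
    involve x. *)
Lemma ideal_gen_cancelX (T : finType) (P : pred T) (g : T -> R) p :
  (forall t, P t -> at0 (g t) = g t) ->
  ideal_gen P g (p * 'X_x) -> ideal_gen P g p.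
Proof.
move=> gx [c Dp]; have [q Dq] := fin_all_exists (fun t => at0_split (c t)).
(* Setting x to 0 in p x gives a relation among the g_t, by which the terms   *)
(* of the c_t that do not involve x can be dropped.                           *)
have : at0 (p * 'X_x) = 0 by rewrite at0M at0XU eqxx mulr0.
have S0 : at0 (\sum_(t | P t) c t * g t) = \sum_(t | P t) at0 (c t) * g t.
  rewrite [LHS](raddf_sum (comp_mpoly _)); apply: eq_bigr => t Pt.
  by rewrite [LHS]at0M gx.
rewrite Dp S0 => S00; exists q.
have nzX : 'X_x != 0 :> R.
  apply/eqP => /(congr1 (mcoeff U_(x)))/eqP.
  by rewrite mcoeffXU eqxx mcoeff0 oner_eq0.
apply: (mulIf nzX); rewrite Dp mulr_suml.
transitivity (\sum_(t | P t) (q t * g t * 'X_x + at0 (c t) * g t)).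
  by apply: eq_bigr => t _; rewrite {1}Dq; ring.
by rewrite big_split /= S00 addr0.
Qed.

End Substitution.

(** * Edge ideals of graphs with a leaf that is a sink *)

Section Graph.
Variables (k : fieldType) (n : nat) (D : wograph n) (x y : 'I_n).
Hypotheses (leafx : leaf D x) (sinkx : sink D x) (Dyx : edge D y x).
Notation R := {mpoly k[n]}.
Notation IDx := (edge_ideal (k := k) (del_vertex D x)).
Notation w := (weight D x).

(** The edge (y, x) is the only one incident to x. *)
Lemma edge_leaf_sink u v :
  edge D u v = ((u, v) == (y, x)) || edge (del_vertex D x) u v.
Proof.
have notDx z : edge D x z = false.
  by case/and3P: sinkx => _ _ /forallP/(_ z)/negPf.
rewrite /= /del_edge xpair_eqE.
have [->|ux] := eqVneq u x.
  rewrite notDx orbF; case: eqP => //= Exy.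
  by move: (edge_irr D x); rewrite {1}Exy Dyx.
have [->|vx] := eqVneq v x; rewrite ?andbF //= andbT orbF.
case/andP: leafx => _ /cards1P[z Nz].
have nbr t : edge D t x -> t = z.
  by move=> Dtx; apply/set1P; rewrite -Nz inE Dtx orbT.
by apply/idP/eqP => [/nbr->|->//]; rewrite (nbr y).
Qed.

(** The edge ideal of D is generated by that of the graph without x and by the
    monomial of the edge (y, x). *)
Lemma edge_ideal_leaf_sink (p : R) :
  edge_ideal D p <-> exists q, IDx (p - q * ('X_y * 'X_x ^+ w)).
Proof.
have Ddel (e : 'I_n * 'I_n) :
    edge (del_vertex D x) e.1 e.2 = edge D e.1 e.2 && (e != (y, x)).
  rewrite edge_leaf_sink -surjective_pairing.
  by case: eqP => [->|]; rewrite ?andbT //= /del_edge eqxx andbF.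
split=> [[c ->]|[q [c Dc]]].
  exists (c (y, x)), c.
  rewrite (bigD1 (y, x)) //= addrAC subrr add0r.
  by apply: eq_bigl => e; rewrite -Ddel.
exists (fun e => if e == (y, x) then q else c e).
rewrite (bigD1 (y, x)) //= eqxx -[p](subrK (q * ('X_y * 'X_x ^+ w))) Dc addrC.
congr (_ + _); rewrite (eq_bigl _ _ Ddel).
by apply: eq_bigr => e /andP[_ /negPf->].
Qed.

(** The variable x does not occur in the generators of the edge ideal of the
    graph without x, so it can be cancelled. *)
Lemma colon_leaf_sink (p : R) :
  colon IDx 'X_y p <-> colon IDx ('X_y * 'X_x ^+ w) p.
Proof.
rewrite /colon mulrA; split=> [|].
  by rewrite [_ * 'X_x ^+ _]mulrC; apply: (gidealM (edge_ideal_graded _ _)).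
elim: (weight D x) => [|m IHm]; first by rewrite mulr1.
rewrite exprSr mulrA => /ideal_gen_cancelX Hm.
apply/IHm/Hm => e /and3P[ux vx _].
rewrite at0M [at0 x (_ ^+ _)]rmorphXn /= -/(at0 _ _) !at0XU.
by rewrite (negPf ux) (negPf vx).
Qed.

(** Lifts of multiplication by the monomial of the edge (y, x) have no constant
    term, by comparison with x^w psi where psi lifts multiplication by y. *)
Lemma graded_lift_constant_part (F G : free_seq k n) (phi : seq_map F G) :
  let f : R := 'X_y * 'X_x ^+ w in
  minimal_free_resolution F (colon IDx f) (w%:Z + 1) ->
  minimal_free_resolution G IDx 0 ->
  graded_lift phi IDx f ->
  forall i, map_mx (mcoeff 0%MM) (phi i) = 0.
Proof.
move=> f mF mG [_ chain lift]; have [[resF minF] [resG _]] := (mF, mG).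
have gI := edge_ideal_graded k (del_vertex D x).
have [||psi [_ chpsi liftpsi]] :=
  graded_lift_exists (c := - w%:Z) (g := 'X_y) gI resF resG.
- by rewrite addKr subr0; apply: homogXU.
- by move=> p /colon_leaf_sink.
pose xw : R := 'X_x ^+ w.
have xw0 : xw@_0 = 0.
  rewrite /xw rmorphXn /= mcoeffX; have w0 := weight_gt0 D x.
  by rewrite -mdeg_eq0 mdeg1 expr0n eqn0Ngt w0.
pose delta i := phi i - xw *: psi i.
have delta0 : forall i, map_mx (mcoeff 0%MM) (delta i) = 0.
  apply: (null_lift_constant_part minF (fdiffM resF) mG) => [i|a].
    by rewrite /delta mulmxBl mulmxBr chain -scalemxAl chpsi scalemxAr.
  rewrite /delta mulmxBl mx_subE -scalemxAl [X in _ - X]mxE.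
  have := gidealB gI (lift a) (gidealM gI xw (liftpsi a)).
  by congr IDx; rewrite /f -/xw; ring.
move=> i; rewrite -[phi i](subrK (xw *: psi i)) map_mxD delta0 add0r.
by apply/matrixP => a b; rewrite !mxE [LHS](rmorphM (mcoeff 0%MM)) /= xw0 mul0r.
Qed.

End Graph.

Theorem theorem6p1 (k : fieldType) (n : nat) (D : wograph n) (x y : 'I_n)
    (hvset : vset D = [set: 'I_n])
    (hsource : sources_have_weight1 D)
    (hleaf : leaf D x)
    (hsink : sink D x)
    (hyx : edge D y x) :
  let w := weight D x in
  let ID : {mpoly k[n]} -> Prop := edge_ideal D in
  let IDx : {mpoly k[n]} -> Prop := edge_ideal (del_vertex D x) in
  let f : {mpoly k[n]} := 'X_y * 'X_x ^+ w in
  [/\ mul_short_exact (colon IDx f) IDx ID f (w%:Z + 1),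
      forall F G : free_seq k n,
        minimal_free_resolution F (colon IDx f) (w%:Z + 1) ->
        minimal_free_resolution G IDx 0 ->
        (exists phi : seq_map F G, graded_lift phi IDx f) /\
        (forall phi : seq_map F G, graded_lift phi IDx f ->
           minimal_free_resolution (mapping_cone phi) ID 0) &
      forall (i j : int) (b1 b2 : nat),
        graded_betti IDx i j b1 ->
        graded_betti (colon IDx 'X_y) (i - 1) (j - w%:Z - 1) b2 ->
        forall b : nat, graded_betti ID i j b <-> b = (b1 + b2)%N].
Proof.
move=> w ID IDx f.
have gI : graded_ideal IDx := edge_ideal_graded k (del_vertex D x).
have IDE (p : {mpoly k[n]}) : ID p <-> exists q, IDx (p - q * f).
  exact: edge_ideal_leaf_sink.
have hf : homog_of_deg (w%:Z + 1) f.
  by rewrite addrC; apply: homogM; [apply: homogXU | apply: homogXUn].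
have lift F G : minimal_free_resolution F (colon IDx f) (w%:Z + 1) ->
    minimal_free_resolution G IDx 0 ->
    exists phi : seq_map F G, graded_lift phi IDx f.
  move=> [resF _] [resG _].
  have [||phi [gphi chain liftphi]] :=
    graded_lift_exists (c := 0) (g := f) gI resF resG => //.
    by rewrite add0r subr0.
  by exists phi; split=> // i a b; have := gphi i a b; rewrite addr0.
have cone F G (phi : seq_map F G) :
    minimal_free_resolution F (colon IDx f) (w%:Z + 1) ->
    minimal_free_resolution G IDx 0 -> graded_lift phi IDx f ->
    minimal_free_resolution (mapping_cone phi) ID 0.
  move=> mF mG liftphi; have [[resF minF] [resG minG]] := (mF, mG); split.
    by apply: (cone_resolution gI _ (colon_graded gI hf) resF resG liftphi IDE).
  by apply: cone_minimal => //; apply: graded_lift_constant_part liftphi.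
split=> [|F G mF mG|i j b1 b2 [G mG nG] [F mF nF] b].
- by split.
- by split=> [|phi]; [apply: lift | apply: cone].
pose F' := fdeg_shift F (w%:Z + 1).
have mF' : minimal_free_resolution F' (colon IDx f) (w%:Z + 1).
  apply: eq_minimal_free_resolution (@colon_leaf_sink k n D x y) _.
  by rewrite -[w%:Z + 1]add0r; apply: shift_resolution.
have [phi /cone mC] := lift _ _ mF' mG.
have nC : num_summands (mapping_cone phi) i j = (b1 + b2)%N.
  by rewrite num_summands_cone num_summands_shift opprD addrA nG nF.
split=> [[H mH <-]|->]; last by exists (mapping_cone phi); first exact: mC.
have gID : graded_ideal ID := edge_ideal_graded k D.
rewrite -nC; apply/eqP.
by rewrite eqn_leq !(num_summands_le _ _ gID) //; apply: mC.
Qed.
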